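(* For any computably bounded numbering $\phi$, the set $\mathrm{MIN}_\phi$ is not $(1,2)$-recursive.
   Context: A numbering $\phi$ is given by a partial-recursive function $U:\mathbb{N}^2\to\mathbb{N}$ via $\phi_e(x)=U(e,x)$. $\phi$ is computably bounded if for every numbering $\psi$ there is a computable $f$ such that for every $e$ some $j\le f(e)$ has $\phi_j=\psi_e$. $\mathrm{MIN}_\phi=\{e:(\forall j<e)\,[\phi_j\ne\phi_e]\}$. A set $A$ is $(1,2)$-recursive if there is a computable function $f$ mapping pairs to label vectors in $\{0,1\}^2$ such that for every pair $(x_1,x_2)$ the vectors $(\chi_A(x_1),\chi_A(x_2))$ and $f(x_1,x_2)$ agree in at least one position. *)

(* Defs.v *)
From mathcomp Require Import all_boot.

Set Implicit Arguments.
Unset Strict Implicit.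
Unset Printing Implicit Defensive.

(** Kleene's mu-recursive schemes; [mrec n] describes partial functions of
    [n] arguments. *)
Inductive mrec : nat -> Type :=
| MZero n : mrec n
| MSucc : mrec 1
| MProj n (i : 'I_n) : mrec n
| MComp k n (f : mrec k) (g : 'I_k -> mrec n) : mrec n
| MPrec n (f : mrec n) (g : mrec n.+2) : mrec n.+1
| MMin n (f : mrec n.+1) : mrec n.

(** [meval p v y]: the function described by [p] is defined at [v], with
    value [y].  Composition is strict.  The recursion variable of [MPrec] and
    the search variable of [MMin] come first; in [MPrec], [s i] is the value at
    [i].  [MMin f] requires [f] to be defined below the zero it returns. *)
Fixpoint meval n (p : mrec n) : n.-tuple nat -> nat -> Prop :=
  match p in mrec n return n.-tuple nat -> nat -> Prop with
  | MZero _ => fun _ y => y = 0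
  | MSucc => fun v y => y = (thead v).+1
  | MProj _ i => fun v y => y = tnth v i
  | MComp k _ f g => fun v y =>
      exists w : k.-tuple nat,
        (forall i, meval (g i) v (tnth w i)) /\ meval f w y
  | MPrec n f g => fun v y =>
      exists s : nat -> nat,
        [/\ meval f (behead_tuple v) (s 0),
            forall i, i < thead v ->
              meval g (cons_tuple i (cons_tuple (s i) (behead_tuple v)))
                    (s i.+1)
          & y = s (thead v)]
  | MMin _ f => fun v y =>
      meval f (cons_tuple y v) 0 /\
      forall z, z < y -> exists t, meval f (cons_tuple z v) t.+1
  end.

Lemma meval_functional n (p : mrec n) v y1 y2 :
  meval p v y1 -> meval p v y2 -> y1 = y2.
Proof.
elim: p v y1 y2 => {n} /= [n|| n i|k n f IHf g IHg|n f IHf g IHg|n f IHf] v y1 y2.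
- by move=> -> ->.
- by move=> -> ->.
- by move=> -> ->.
- move=> [w1 [g1 f1]] [w2 [g2 f2]]; suff e : w1 = w2 by apply: IHf f1 _; rewrite e.
  by apply: eq_from_tnth => i; apply: IHg (g1 i) (g2 i).
- move=> [s1 [f1 g1 ->]] [s2 [f2 g2 ->]].
  suff: forall m, m <= thead v -> s1 m = s2 m by apply.
  elim=> [_|m IHm lt_m]; first exact: IHf f1 f2.
  by apply: IHg (g1 m lt_m) _; rewrite IHm ?(ltnW lt_m) //; apply: g2.
- move=> [z1 lt1] [z2 lt2]; case: (ltngtP y1 y2) => // lt_y.
  + by have [t /IHf/(_ z1)] := lt2 _ lt_y.
  + by have [t /IHf/(_ z2)] := lt1 _ lt_y.
Qed.

(** A partial function is given by its graph; graphs of partial recursive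
    functions are single-valued by [meval_functional]. *)
Definition partial_recursive n (F : n.-tuple nat -> nat -> Prop) : Prop :=
  exists p : mrec n, forall v y, F v y <-> meval p v y.

Definition computable1 (f : nat -> nat) : Prop :=
  partial_recursive (fun (v : 1.-tuple nat) y => y = f (thead v)).

Definition computable2 (f : nat -> nat -> nat) : Prop :=
  partial_recursive
    (fun (v : 2.-tuple nat) y => y = f (tnth v ord0) (tnth v ord_max)).

Record numbering := Numbering {
  num_graph : 2.-tuple nat -> nat -> Prop;
  num_partial_recursive : partial_recursive num_graph
}.

(** [num_fun phi e x y]: [phi_e(x)] is defined and equal to [y]. *)
Definition num_fun (phi : numbering) (e x y : nat) : Prop :=
  num_graph phi [tuple e; x] y.

(** Equality of partial functions: same domain, same values. *)
Definition pfun_eq (F G : nat -> nat -> Prop) : Prop :=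
  forall x y, F x y <-> G x y.

Definition computably_bounded (phi : numbering) : Prop :=
  forall psi : numbering, exists f : nat -> nat,
    computable1 f /\
    forall e, exists2 j, j <= f e & pfun_eq (num_fun phi j) (num_fun psi e).

Definition MIN (phi : numbering) (e : nat) : Prop :=
  forall j, j < e -> ~ pfun_eq (num_fun phi j) (num_fun phi e).

(** The value at [x] of the characteristic function of [A] is [b]. *)
Definition char_val (A : nat -> Prop) (x : nat) (b : bool) : Prop :=
  A x <-> b = true.

Definition recursive_1_2 (A : nat -> Prop) : Prop :=
  exists f : nat -> nat -> bool * bool,
    [/\ computable2 (fun x1 x2 => nat_of_bool (f x1 x2).1),
        computable2 (fun x1 x2 => nat_of_bool (f x1 x2).2)
      & forall x1 x2,
          char_val A x1 (f x1 x2).1 \/ char_val A x2 (f x1 x2).2].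

(* Main.v *)
Require Import Defs.
From Stdlib Require Import Setoid Classical.
From mathcomp Require Import all_boot.

Set Implicit Arguments.
Unset Strict Implicit.
Unset Printing Implicit Defensive.

(** Suppose [MIN phi] is (1,2)-recursive via [f].  By the recursion theorem a
    program can know a bound on its own least index; copying [phi_x] for some
    [x] above that bound makes [x] non-minimal.  Hence [MIN phi] is immune, and
    [f] gives the vector (1,1) on no pair of large numbers.  The other three
    vectors say "[y] minimal implies [x] minimal", its converse, or "not both
    minimal": [MIN phi] is a branch of a computable forest.  As [MIN phi] is
    immune and meets a computable sequence of intervals, every large
    non-minimal [j] is refuted by a confluence of incompatible elements below
    it, or by a minimal [y] incompatible with it.  Since minimality of [y] is
    Sigma_2, non-minimality of [j] is too.
    Let [g] be the zero function on an initial segment which grows while no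
    bound [w] seems to witness, for each [j] up to the bound on the index of
    [g], that [j] is non-minimal or that [phi_j] differs from the zero
    function.  A correct [w] exists, so [g] is finite, longer than its least
    correct [w], and different from all the [phi_j]: a contradiction. *)

(** * Closure properties of total recursive functions and decidable predicates *)

(** Arguments are passed as a list; only lists of size [n] matter. *)
Definition total_rec n (f : seq nat -> nat) : Prop :=
  exists p : mrec n, forall v : n.-tuple nat, meval p v (f v).

Definition dec n (b : seq nat -> bool) : Prop :=
  total_rec n (fun v => nat_of_bool (b v)).

Lemma rec_ext n f g :
  total_rec n f -> (forall v, size v = n -> f v = g v) -> total_rec n g.
Proof. by move=> [p pP] e; exists p => v; rewrite -e ?size_tuple. Qed.

Lemma rec_var n i : i < n -> total_rec n (fun v => nth 0 v i).
Proof.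
by move=> lt_in; exists (MProj (Ordinal lt_in)) => v /=; rewrite (tnth_nth 0).
Qed.

Lemma rec_compT k n f (g : 'I_k -> seq nat -> nat) :
  total_rec k f -> (forall i, total_rec n (g i)) ->
  total_rec n (fun v => f [seq g i v | i <- enum 'I_k]).
Proof.
move=> [p pP] /fin_all_exists[q qP]; exists (MComp p q) => v /=.
exists [tuple g i v | i < k]; split; last exact: pP.
by move=> i; rewrite tnth_mktuple.
Qed.

Lemma rec_zero n : total_rec n (fun _ => 0).
Proof. by exists (MZero n). Qed.

Lemma rec_comp n f (gs : seq (seq nat -> nat)) :
  total_rec (size gs) f ->
  (forall i, i < size gs -> total_rec n (nth (fun _ => 0) gs i)) ->
  total_rec n (fun v => f [seq g v | g <- gs]).
Proof.
move=> fP gP; apply: rec_ext (rec_compT fP (fun i => gP i (ltn_ord i))) _.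
move=> v _; congr f.
rewrite (map_comp (fun i => nth (fun _ => 0) gs i v) (@nat_of_ord _)) val_enum_ord.
rewrite -[in RHS](mkseq_nth (fun _ => 0) gs) /mkseq -map_comp.
exact: eq_map.
Qed.

(** Any rearrangement of arguments is composition with projections; weakening, skipping and swapping
    below are instances. *)
Lemma rec_reindex n f (idx : seq nat) :
  total_rec (size idx) f -> all (fun i => i < n) idx ->
  total_rec n (fun v => f [seq nth 0 v i | i <- idx]).
Proof.
move=> fP /allP idxP.
have := @rec_comp n f [seq (fun v => nth 0 v i) | i <- idx].
rewrite size_map => /(_ fP) H.
apply: rec_ext (H _) _ => [i lt_i|v _]; last by rewrite -map_comp.
by rewrite (nth_map 0) //; apply/rec_var/idxP/mem_nth.
Qed.

Lemma map_nth_drop n k (v : seq nat) : size v = k + n ->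
  [seq nth 0 v i | i <- iota k n] = drop k v.
Proof.
move=> sz; rewrite map_nth_iota ?sz ?addKn //.
by rewrite take_oversize // size_drop sz addKn.
Qed.

Lemma rec_wk n f : total_rec n f -> total_rec n.+1 (fun v => f (behead v)).
Proof.
move=> fP; apply: rec_ext (@rec_reindex n.+1 f (iota 1 n) _ _) _.
- by rewrite size_iota.
- by apply/allP => i; rewrite mem_iota => /andP[].
- by move=> v sz; rewrite map_nth_drop ?sz // drop1.
Qed.

Lemma rec_skip n f : total_rec n.+1 f ->
  total_rec n.+2 (fun w => f (nth 0 w 0 :: behead (behead w))).
Proof.
move=> fP; apply: rec_ext (@rec_reindex n.+2 f (0 :: iota 2 n) _ _) _.
- by rewrite /= size_iota.
- by apply/allP => i; rewrite !inE mem_iota => /orP[/eqP->|/andP[]].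
- by move=> v sz; rewrite /= map_nth_drop ?sz //= -drop1 -[behead _]drop1 drop_drop.
Qed.

Lemma rec_swap n f : total_rec n.+2 f ->
  total_rec n.+2 (fun w => f (nth 0 w 1 :: nth 0 w 0 :: behead (behead w))).
Proof.
move=> fP; apply: rec_ext (@rec_reindex n.+2 f (1 :: 0 :: iota 2 n) _ _) _.
- by rewrite /= size_iota.
- by apply/allP => i; rewrite !inE mem_iota => /or3P[/eqP->|/eqP->|/andP[]].
- by move=> v sz; rewrite /= map_nth_drop ?sz //= -drop1 -[behead _]drop1 drop_drop.
Qed.

Lemma rec_comp1 n f a :
  total_rec 1 (fun v => f (nth 0 v 0)) -> total_rec n a ->
  total_rec n (fun v => f (a v)).
Proof.
by move=> fP aP; apply: (@rec_comp n (fun v => f (nth 0 v 0)) [:: a]) => // -[|i] //.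
Qed.

Lemma rec_comp2 n f a b :
  total_rec 2 (fun v => f (nth 0 v 0) (nth 0 v 1)) ->
  total_rec n a -> total_rec n b -> total_rec n (fun v => f (a v) (b v)).
Proof.
move=> fP aP bP.
by apply: (@rec_comp n (fun v => f (nth 0 v 0) (nth 0 v 1)) [:: a; b]) => // -[|[|i]] //.
Qed.

Lemma rec_comp3 n f a b c :
  total_rec 3 (fun v => f (nth 0 v 0) (nth 0 v 1) (nth 0 v 2)) ->
  total_rec n a -> total_rec n b -> total_rec n c ->
  total_rec n (fun v => f (a v) (b v) (c v)).
Proof.
move=> fP aP bP cP.
by apply: (@rec_comp n (fun v => f (nth 0 v 0) (nth 0 v 1) (nth 0 v 2))
             [:: a; b; c]) => // -[|[|[|i]]] //.
Qed.

Lemma rec_succ n a : total_rec n a -> total_rec n (fun v => (a v).+1).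
Proof.
apply: (@rec_comp1 n S); exists MSucc => v /=.
by rewrite /thead (tnth_nth 0).
Qed.

Lemma rec_const n c : total_rec n (fun _ => c).
Proof. by elim: c => [|c IH]; [exact: rec_zero|exact: rec_succ]. Qed.

Definition primrec (x : nat) (F : nat -> nat -> nat) (m : nat) : nat :=
  nat_rec (fun _ => nat) x F m.

Lemma rec_primrec n x F m :
  total_rec n x ->
  total_rec n.+2 (fun w => F (nth 0 w 0) (nth 0 w 1) (behead (behead w))) ->
  total_rec n m ->
  total_rec n (fun v => primrec (x v) (fun i r => F i r v) (m v)).
Proof.
move=> [px xP] [pF FP] mP.
have H : total_rec n.+1 (fun v => primrec (x (behead v))
    (fun i r => F i r (behead v)) (nth 0 v 0)).
  exists (MPrec px pF) => v /=.
  exists (fun m => primrec (x (behead v)) (fun i r => F i r (behead v)) m); split.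
  - exact: (xP (behead_tuple v)).
  - by move=> i _; apply: FP.
  - by rewrite /thead (tnth_nth 0).
have := @rec_comp n _ (m :: [seq (fun v => nth 0 v i) | i <- iota 0 n]).
rewrite /= size_map size_iota => /(_ _ H) K.
apply: rec_ext (K _) _ => [[//|i] /= lt_i|v sz /=].
  by rewrite (nth_map 0) ?size_iota // nth_iota //; exact: rec_var.
by rewrite -map_comp /comp -[map _ _](_ : v = _) // map_nth_drop ?drop0.
Qed.

Lemma rec_at n f i : i < n -> (forall v, f v = nth 0 v i) -> total_rec n f.
Proof. by move=> lt_i e; apply: rec_ext (rec_var lt_i) _ => v _; rewrite e. Qed.

Ltac recvar :=
  eapply rec_at; [| move=> ?; rewrite ?nth_behead; reflexivity]; by [].

Lemma rec_add n a b :
  total_rec n a -> total_rec n b -> total_rec n (fun v => a v + b v).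
Proof.
apply: rec_comp2.
apply: rec_ext (@rec_primrec 2 (fun v => nth 0 v 0) (fun _ r _ => r.+1)
  (fun v => nth 0 v 1) _ _ _) _; try recvar.
  by apply: rec_succ; recvar.
by move=> v _; elim: (nth 0 v 1) => //= [|m ->]; rewrite ?addn0 ?addnS.
Qed.

Lemma rec_mul n a b :
  total_rec n a -> total_rec n b -> total_rec n (fun v => a v * b v).
Proof.
apply: rec_comp2.
apply: rec_ext (@rec_primrec 2 (fun v => 0) (fun _ r v => r + nth 0 v 0)
  (fun v => nth 0 v 1) _ _ _) _; try recvar.
- exact: rec_zero.
- by apply: rec_add; recvar.
- by move=> v _; elim: (nth 0 v 1) => //= [|m ->]; rewrite ?muln0 // mulnS addnC.
Qed.

Lemma rec_pred n a : total_rec n a -> total_rec n (fun v => (a v).-1).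
Proof.
apply: (@rec_comp1 _ predn).
apply: rec_ext (@rec_primrec 1 (fun v => 0) (fun i _ _ => i)
  (fun v => nth 0 v 0) _ _ _) _; try recvar; first exact: rec_zero.
by move=> v _; case: (nth 0 v 0).
Qed.

Lemma rec_sub n a b :
  total_rec n a -> total_rec n b -> total_rec n (fun v => a v - b v).
Proof.
apply: rec_comp2.
apply: rec_ext (@rec_primrec 2 (fun v => nth 0 v 0) (fun _ r _ => r.-1)
  (fun v => nth 0 v 1) _ _ _) _; try recvar.
  by apply: rec_pred; recvar.
by move=> v _; elim: (nth 0 v 1) => //= [|m ->]; rewrite ?subn0 ?subnS.
Qed.

Lemma dec_wk n b : dec n b -> dec n.+1 (fun v => b (behead v)).
Proof. exact: (@rec_wk n (fun v => nat_of_bool (b v))). Qed.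

Lemma dec_const n b : dec n (fun _ => b).
Proof. exact: rec_const. Qed.

Lemma dec_leq n a b :
  total_rec n a -> total_rec n b -> dec n (fun v => a v <= b v).
Proof.
move=> aP bP; apply: rec_ext (rec_sub (rec_const n 1) (rec_sub aP bP)) _ => v _.
by rewrite /leq; case: (a v - b v) => [|k]; rewrite ?subn0 ?subSS ?sub0n.
Qed.

Lemma dec_not n b : dec n b -> dec n (fun v => ~~ b v).
Proof.
move=> bP; apply: rec_ext (rec_sub (rec_const n 1) bP) _ => v _.
by case: (b v).
Qed.

Lemma dec_and n b c : dec n b -> dec n c -> dec n (fun v => b v && c v).
Proof.
move=> bP cP; apply: rec_ext (rec_mul bP cP) _ => v _.
by case: (b v); case: (c v).
Qed.

Lemma dec_ext n b c : dec n b -> (forall v, size v = n -> b v = c v) -> dec n c.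
Proof. by move=> bP e; apply: rec_ext bP _ => v /e ->. Qed.

Lemma dec_or n b c : dec n b -> dec n c -> dec n (fun v => b v || c v).
Proof.
move=> bP cP; apply: dec_ext (dec_not (dec_and (dec_not bP) (dec_not cP))) _.
by move=> v _; rewrite negb_and !negbK.
Qed.

Lemma dec_eq n a b :
  total_rec n a -> total_rec n b -> dec n (fun v => a v == b v).
Proof.
move=> aP bP; apply: dec_ext (dec_and (dec_leq aP bP) (dec_leq bP aP)) _.
by move=> v _; rewrite eqn_leq.
Qed.

Lemma rec_if n b x y : dec n b -> total_rec n x -> total_rec n y ->
  total_rec n (fun v => if b v then x v else y v).
Proof.
move=> bP xP yP.
apply: rec_ext (rec_add (rec_mul bP xP) (rec_mul (dec_not bP) yP)) _ => v _.
by case: (b v); rewrite /= ?mul1n ?mul0n ?addn0.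
Qed.

Lemma dec_all n (I : Type) (s : seq I) (b : I -> seq nat -> bool) :
  (forall i, dec n (b i)) -> dec n (fun v => all (b^~ v) s).
Proof.
move=> bP; elim: s => [|i s IHs] /=; first exact: dec_const.
exact: dec_and.
Qed.

Lemma dec_has n P m :
  dec n.+1 (fun w => P (nth 0 w 0) (behead w)) -> total_rec n m ->
  dec n (fun v => has (fun i => P i v) (iota 0 (m v))).
Proof.
move=> PP mP.
apply: rec_ext (@rec_primrec n (fun v => 0) (fun i r v => P i v || (0 < r))
  m _ _ _) _ => //; first exact: rec_zero.
  refine (dec_or (b := fun w => P (nth 0 w 0) (behead (behead w))) (c := fun w => 0 < nth 0 w 1) _ _); last by apply: dec_leq; [exact: rec_const|recvar].
  exact: rec_ext (rec_skip PP) _.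
move=> v _; elim: (m v) => // k IHk.
by rewrite -[in iota _ _]addn1 iotaD has_cat /= add0n IHk orbF orbC; case: has; case: (P k v).
Qed.

Lemma dec_ball n P m :
  dec n.+1 (fun w => P (nth 0 w 0) (behead w)) -> total_rec n m ->
  dec n (fun v => all (fun i => P i v) (iota 0 (m v))).
Proof.
move=> PP mP.
have := @dec_has n (fun i v => ~~ P i v) m (dec_not PP) mP.
move=> /dec_not H; apply: dec_ext H _ => v _.
by rewrite -all_predC; apply: eq_all => i /=; rewrite negbK.
Qed.

(** Bounded search by primitive recursion: the counter stops moving once it satisfies [P], and the
    default when nothing below [m] does is [m] itself. *)
Definition bmin (P : pred nat) (m : nat) : nat :=
  primrec 0 (fun _ r => if P r then r else r.+1) m.

Lemma bminP (P : pred nat) m : bmin P m <= m /\ (forall i, i < bmin P m -> ~~ P i)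
  /\ (P (bmin P m) \/ bmin P m = m).
Proof.
elim: m => [|m [le_m [ltP Pm_or]]]; first by split=> //; split=> //; right.
rewrite /bmin /= -/(bmin P m); case: ifP => Pm.
  by split; [exact: leqW|split=> //; left].
split; first by [].
split; last by case: Pm_or => [|->]; [rewrite Pm|right].
move=> i; rewrite ltnS leq_eqVlt => /orP[/eqP->|/ltP//].
by rewrite Pm.
Qed.

Lemma bmin_sat (P : pred nat) m i : P i -> i <= m -> P (bmin P m).
Proof.
move=> Pi le_i; have [_ [ltP [//|e]]] := bminP P m.
move: le_i; rewrite -{1}e leq_eqVlt => /orP[/eqP<-//|/ltP].
by rewrite Pi.
Qed.

Lemma rec_bmin n (P : nat -> seq nat -> bool) m :
  dec n.+1 (fun w => P (nth 0 w 0) (behead w)) -> total_rec n m ->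
  total_rec n (fun v => bmin (fun i => P i v) (m v)).
Proof.
move=> PP mP.
apply: (@rec_primrec n (fun _ => 0) (fun _ r v => if P r v then r else r.+1)).
- exact: rec_zero.
- apply: rec_if; try apply: rec_succ; try recvar.
  apply: dec_ext (rec_wk PP) _ => v _.
  by rewrite nth_behead.
- exact: mP.
Qed.

Ltac rect := repeat lazymatch goal with
  | |- dec _ _ => first
    [ assumption | refine (dec_const _ _) | refine (dec_not _)
    | refine (dec_and _ _) | refine (dec_or _ _) | refine (dec_leq _ _)
    | refine (dec_eq _ _) ]
  | |- total_rec _ _ => first
    [ recvar | assumption | refine (rec_const _ _) | refine (rec_if _ _ _)
    | refine (rec_succ _) | refine (rec_add _ _) | refine (rec_mul _ _)
    | refine (rec_pred _) | refine (rec_sub _ _) ]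
  end.

(** * Recursively enumerable predicates *)

(** The extra first argument of [b] counts computation steps. *)
Definition re n (P : seq nat -> Prop) : Prop :=
  exists b : seq nat -> bool,
    [/\ dec n.+1 b,
        forall s t v, size v = n -> s <= t -> b (s :: v) -> b (t :: v)
      & forall v, size v = n -> (P v <-> exists s, b (s :: v))].

Lemma re_ext n P Q :
  re n P -> (forall v, size v = n -> (P v <-> Q v)) -> re n Q.
Proof.
move=> [b [bP mono bE]] e; exists b; split=> // v sz.
by rewrite -e ?bE.
Qed.

Lemma re_dec n b : dec n b -> re n (fun v => b v).
Proof.
move=> bP; exists (fun w => b (behead w)); split=> //; first exact: dec_wk.
by move=> v sz; split=> [bv|[]//]; exists 0.
Qed.

Lemma re_and n P Q : re n P -> re n Q -> re n (fun v => P v /\ Q v).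
Proof.
move=> [b [bP bM bE]] [c [cP cM cE]]; exists (fun w => b w && c w); split.
- exact: dec_and.
- by move=> s t v sz le_st /andP[/bM-> // /cM->].
- move=> v sz; rewrite bE ?cE //; split=> [[[s bs] [t ct]]|[s /andP[bs cs]]].
    exists (maxn s t); rewrite (bM s) ?leq_maxl //.
    by rewrite (cM t) ?leq_maxr.
  by split; exists s.
Qed.

Lemma re_or n P Q : re n P -> re n Q -> re n (fun v => P v \/ Q v).
Proof.
move=> [b [bP bM bE]] [c [cP cM cE]]; exists (fun w => b w || c w); split.
- exact: dec_or.
- move=> s t v sz le_st /orP[/bM-> //|/cM->] //; by rewrite orbT.
- move=> v sz; rewrite bE ?cE //.
  split=> [[[s bs]|[s cs]]|[s /orP[bs|cs]]]; first by exists s; rewrite bs.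
  + by exists s; rewrite cs orbT.
  + by left; exists s.
  + by right; exists s.
Qed.

(** Dovetailing: a single stage bounds both the candidate witness and the steps spent on it. *)
Lemma re_ex n P :
  re n.+1 (fun w => P (nth 0 w 0) (behead w)) -> re n (fun v => exists y, P y v).
Proof.
move=> [b [bP bM bE]].
exists (fun w => has (fun y => b (nth 0 w 0 :: y :: behead w)) (iota 0 (nth 0 w 0))).
split.
- apply: dec_has; last by recvar.
  apply: dec_ext (rec_swap bP) _ => w _.
  by rewrite nth_behead.
- move=> s t v sz le_st /= /hasP[y]; rewrite mem_iota /= => lt_y bs.
  apply/hasP; exists y; first by rewrite mem_iota (leq_trans lt_y).
  by apply: bM bs => //=; rewrite sz.
- move=> v sz; split=> [[y]|[s /hasP[y _ bs]]]; last first.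
    by exists y; apply/(bE (y :: v)); rewrite /= ?sz //; exists s.
  move=> /(bE (y :: v)); rewrite /= sz => /(_ erefl)[s bs].
  exists (maxn s y.+1); apply/hasP; exists y.
    by rewrite mem_iota /= leq_maxr.
  by apply: bM bs; rewrite /= ?sz // leq_maxl.
Qed.

(** A maximum of finitely many thresholds; it turns stagewise facts under a bounded quantifier into
    facts at one common stage. *)
Lemma bounded_collect (Q : nat -> nat -> Prop) m :
  (forall i s t, s <= t -> Q i s -> Q i t) ->
  (forall i, i < m -> exists s, Q i s) -> exists s, forall i, i < m -> Q i s.
Proof.
move=> mono; elim: m => [|m IHm] H; first by exists 0.
have [i /leqW/H//|s sP] := IHm; have [t tP] := H m (ltnSn m).
exists (maxn s t) => i; rewrite ltnS leq_eqVlt => /orP[/eqP->|/sP].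
  by apply: mono tP; rewrite leq_maxr.
by apply: mono; rewrite leq_maxl.
Qed.

Lemma re_ball n P m :
  re n.+1 (fun w => P (nth 0 w 0) (behead w)) -> total_rec n m ->
  re n (fun v => forall i, i < m v -> P i v).
Proof.
move=> [b [bP bM bE]] mP.
exists (fun w => all (fun y => b (nth 0 w 0 :: y :: behead w)) (iota 0 (m (behead w)))).
split.
- apply: dec_ball; last exact: rec_wk.
  apply: dec_ext (rec_swap bP) _ => w _.
  by rewrite nth_behead.
- move=> s t v sz le_st /= /allP H; apply/allP => y /H.
  by apply: bM => //=; rewrite sz.
- move=> v sz; split=> [H|[s /= /allP H i lt_i]]; last first.
    by apply/(bE (i :: v)); rewrite /= ?sz //; exists s; apply: H; rewrite mem_iota.
  have [i s t le_st|i lt_i|s sP] := @bounded_collect (fun i s => b [:: s, i & v]) (m v).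
  + by apply: bM; rewrite /= ?sz.
  + by apply/(bE (i :: v)); rewrite /= ?sz //; apply: H.
  + by exists s => /=; apply/allP => i; rewrite mem_iota => /andP[_]; apply: sP.
Qed.

Lemma re_comp n P (gs : seq (seq nat -> nat)) :
  re (size gs) P ->
  (forall i, i < size gs -> total_rec n (nth (fun _ => 0) gs i)) ->
  re n (fun v => P [seq g v | g <- gs]).
Proof.
move=> [b [bP bM bE]] gP.
exists (fun w => b (nth 0 w 0 :: [seq g (behead w) | g <- gs])); split.
- have := @rec_comp n.+1 b ((fun w => nth 0 w 0) ::
     [seq (fun w => g (behead w)) | g <- gs]).
  rewrite /= size_map => /(_ bP) H.
  apply: rec_ext (H _) _ => [[_|i lt_i]|w _] /=; first by recvar.
    by rewrite (nth_map (fun _ => 0)) //; apply/rec_wk/gP.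
  by rewrite -map_comp.
- by move=> s t v sz; apply: bM; rewrite size_map.
- by move=> v _; apply: bE; rewrite size_map.
Qed.

Lemma re_comp1 n P a :
  re 1 (fun v => P (nth 0 v 0)) -> total_rec n a -> re n (fun v => P (a v)).
Proof.
move=> PP aP.
by apply: (@re_comp n (fun v => P (nth 0 v 0)) [:: a]) => // -[|i] //.
Qed.

Lemma re_comp2 n P a b :
  re 2 (fun v => P (nth 0 v 0) (nth 0 v 1)) ->
  total_rec n a -> total_rec n b -> re n (fun v => P (a v) (b v)).
Proof.
move=> PP aP bP.
by apply: (@re_comp n (fun v => P (nth 0 v 0) (nth 0 v 1)) [:: a; b]) => // -[|[|i]] //.
Qed.

Lemma re_comp3 n P a b c :
  re 3 (fun v => P (nth 0 v 0) (nth 0 v 1) (nth 0 v 2)) ->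
  total_rec n a -> total_rec n b -> total_rec n c ->
  re n (fun v => P (a v) (b v) (c v)).
Proof.
move=> PP aP bP cP.
by apply: (@re_comp n (fun v => P (nth 0 v 0) (nth 0 v 1) (nth 0 v 2))
             [:: a; b; c]) => // -[|[|[|i]]] //.
Qed.

Lemma re_comp4 n P a b c d :
  re 4 (fun v => P (nth 0 v 0) (nth 0 v 1) (nth 0 v 2) (nth 0 v 3)) ->
  total_rec n a -> total_rec n b -> total_rec n c -> total_rec n d ->
  re n (fun v => P (a v) (b v) (c v) (d v)).
Proof.
move=> PP aP bP cP dP.
by apply: (@re_comp n (fun v => P (nth 0 v 0) (nth 0 v 1) (nth 0 v 2) (nth 0 v 3))
             [:: a; b; c; d]) => // -[|[|[|[|i]]]] //.
Qed.

(** The program searches for the first stage [u] at which some [y < u] is accepted, then outputs the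
    least [y] accepted at stage [u]. *)
Lemma re_uniformization n P : re n.+1 P ->
  exists p : mrec n, forall v : n.-tuple nat,
    (forall y, meval p v y -> P (y :: v)) /\
    ((exists y, P (y :: v)) -> exists y, meval p v y).
Proof.
move=> [b [bP bM bE]].
pose c w := has (fun y => b (nth 0 w 0 :: y :: behead w)) (iota 0 (nth 0 w 0)).
pose x w := bmin (fun y => b (nth 0 w 0 :: y :: behead w)) (nth 0 w 0).
have swP : dec n.+2 (fun w => b (nth 0 (behead w) 0 :: nth 0 w 0 :: behead (behead w))).
  by apply: dec_ext (rec_swap bP) _ => w _; rewrite nth_behead.
have [q qP] : dec n.+1 (fun w => ~~ c w).
  by apply/dec_not/dec_has; last by recvar.
have [r rP] : total_rec n.+1 x by apply: rec_bmin; last by recvar.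
(* Argument [0] of [r] is the stage found by minimization, the remaining ones copy [v]. The test [q]
   is total, with value [0] exactly when [c] holds. *)
exists (MComp r (fun i => if unlift ord0 i is Some j then MProj j else MMin q)) => v.
have cE u : c (u :: v) -> P (x (u :: v) :: v).
  case/hasP => y; rewrite mem_iota /= => lt_y by_; apply/bE.
    by rewrite /= size_tuple.
  exists u; apply: (@bmin_sat (fun y => b [:: u, y & v]) u y) by_ _.
  exact: ltnW.
split=> [y /= [w [gP rw]]|[y /bE]].
  have := gP ord0; rewrite unlift_none /= => -[qw _].
  have ew : tval w = tnth w ord0 :: v.
    apply: (@eq_from_nth _ 0); first by rewrite /= !size_tuple.
    move=> [|i] lt_i; first by rewrite (tnth_nth 0).
    move: (lt_i); rewrite size_tuple ltnS => lt_in.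
    have := gP (lift ord0 (Ordinal lt_in)); rewrite liftK /=.
    by rewrite !(tnth_nth 0) /= /bump /= => ->.
  rewrite (meval_functional rw (rP w)) ew; apply: cE.
  have := meval_functional (qP _) qw; rewrite /=.
  by case: (c _).
rewrite /= size_tuple => /(_ erefl)[s bs].
have cs : c (maxn s y.+1 :: v).
  apply/hasP; exists y; first by rewrite mem_iota /= leq_maxr.
  by apply: bM bs; rewrite /= ?size_tuple // leq_maxl.
have exc : exists u, c (u :: v) by exists (maxn s y.+1).
exists (x (ex_minn exc :: v)) => /=; exists (cons_tuple (ex_minn exc) v); split.
  move=> i; case: unliftP => [j|] -> /=.
    by rewrite !(tnth_nth 0) /= /bump.
  rewrite (tnth_nth 0) /=; case: ex_minnP => u cu u_min; split.
    by have := qP (cons_tuple u v); rewrite /= cu.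
  move=> z lt_z; exists 0; have := qP (cons_tuple z v); rewrite /=.
  by case: (boolP (c _)) => // /u_min; rewrite leqNgt lt_z.
exact: rP.
Qed.

(** * Stagewise evaluation of mu-recursive programs *)

(** [T (s :: v)] is [y.+1] once the computation has converged to [y] within
    [s] steps, and [0] before that. *)
Definition stage_fun n (F : n.-tuple nat -> nat -> Prop) (T : seq nat -> nat) :=
  [/\ total_rec n.+1 T,
      forall s t v y, size v = n -> s <= t -> T (s :: v) = y.+1 -> T (t :: v) = y.+1
    & forall (v : n.-tuple nat) y, F v y <-> exists s, T (s :: v) = y.+1].

(** All components run for the same number of steps, and the outer function starts only when each of
    them has converged. *)
Lemma stage_comp k n (f : mrec k) (g : 'I_k -> mrec n) :
  (exists T, stage_fun (meval f) T) ->
  (forall i, exists T, stage_fun (meval (g i)) T) ->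
  exists T, stage_fun (meval (MComp f g)) T.
Proof.
move=> [Tf [TfP TfM TfE]] /fin_all_exists[Tg TgP].
pose T w := if all (fun i => 0 < Tg i w) (enum 'I_k)
  then Tf (nth 0 w 0 :: [seq (Tg i w).-1 | i <- enum 'I_k]) else 0.
exists T; split.
- apply: rec_if.
  + apply: dec_all => i; have [? _ _] := TgP i; by rect.
  + have := @rec_comp n.+1 Tf ((fun w => nth 0 w 0) ::
      [seq (fun w => (Tg i w).-1) | i <- enum 'I_k]).
    rewrite /= size_map size_enum_ord => /(_ TfP) H.
    apply: rec_ext (H _) _ => [[_|i lt_i]|w _] /=; first by recvar.
      have lt_ik : i < k by [].
      rewrite (nth_map (Ordinal lt_ik)) ?size_enum_ord //.
      by apply: rec_pred; have [] := TgP (nth (Ordinal lt_ik) (enum 'I_k) i).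
    by rewrite -map_comp.
  + exact: rec_const.
- move=> s t v y sz le_st; rewrite /T; case: ifP => // /allP Hs.
  have e i : Tg i (t :: v) = Tg i (s :: v).
    have := Hs i (mem_enum _ _); have [_ mono _] := TgP i.
    by case E: (Tg i (s :: v)) => [|z] /= h; last exact: mono E.
  rewrite (eq_all (a2 := fun i => 0 < Tg i (s :: v))); last by move=> i; rewrite e.
  rewrite (introT allP Hs) (eq_map (g := fun i => (Tg i (s :: v)).-1)) => [|i].
    by apply: TfM; rewrite /= 1?size_map ?size_enum_ord.
  by rewrite e.
- move=> v y; split=> [[w [gP fP]]|[s]].
  + have [//|i lt_i|s0 s0P] := @bounded_collect
      (fun i s => forall j : 'I_k, j = i :> nat -> Tg j (s :: v) = (tnth w j).+1) k.
    * move=> i s t le_st H j /H; have [_ mono _] := TgP j.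
      by apply: mono; rewrite ?size_tuple.
    * have [_ _ /(_ v (tnth w (Ordinal lt_i)))[H _]] := TgP (Ordinal lt_i).
      have [s sP] := H (gP _); exists s => j e.
      by have -> : j = Ordinal lt_i by apply: val_inj.
    * have /TfE[s1 s1P] := fP; exists (maxn s0 s1).
      have e i : Tg i (maxn s0 s1 :: v) = (tnth w i).+1.
        have [_ mono _] := TgP i.
        apply: (mono s0); rewrite ?size_tuple ?leq_maxl //.
        exact: (s0P i).
      rewrite /T (eq_all (a2 := xpredT)) => [|i]; last by rewrite e.
      rewrite all_predT /= (eq_map (g := tnth w)) => [|i]; last by rewrite e.
      by rewrite map_tnth_enum; apply: TfM s1P; rewrite ?size_tuple ?leq_maxr.
  + rewrite /T; case: ifP => // /allP pos Ty.
    exists [tuple (Tg i (s :: v)).-1 | i < k]; split; last by apply/TfE; exists s.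
    move=> i; have [_ _ E] := TgP i; apply/E; exists s.
    by rewrite tnth_mktuple prednK // pos ?mem_enum.
Qed.

(** The recursion is iterated on values shifted by one, with [0] (not yet converged) absorbing. *)
Lemma stage_prec n (f : mrec n) (g : mrec n.+2) :
  (exists T, stage_fun (meval f) T) -> (exists T, stage_fun (meval g) T) ->
  exists T, stage_fun (meval (MPrec f g)) T.
Proof.
move=> [Tf [TfP TfM TfE]] [Tg [TgP TgM TgE]].
pose I s v m := primrec (Tf (s :: v)) (fun i r =>
  if r == 0 then 0 else Tg [:: s, i, r.-1 & v]) m.
have IM s t v m y : size v = n -> s <= t -> I s v m = y.+1 -> I t v m = y.+1.
  move=> sz le_st; elim: m y => [|m IHm] y; first exact: TfM.
  rewrite /I /= -/(I s v m) -/(I t v m); case: eqP => //.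
  case E: (I s v m) => [//|z] _; rewrite (IHm _ E) /=.
  by apply: TgM => //=; rewrite sz.
exists (fun w => I (nth 0 w 0) (behead (behead w)) (nth 0 w 1)); split.
- have TfP' := rec_skip TfP.
  apply: (@rec_primrec n.+2 _ (fun i r w => if r == 0 then 0 else
    Tg [:: nth 0 w 0, i, r.-1 & behead (behead w)]) (fun w => nth 0 w 1)) => //;
    last by recvar.
  apply: rec_if; [by rect | by rect |].
  (* The arguments are [i], [r], [s], [m] and then the parameters, so [s] sits at position 2 and the
     parameters start at 4. *)
  have := @rec_comp n.+4 Tg [:: fun w => nth 0 w 2, fun w => nth 0 w 0,
     fun w => (nth 0 w 1).-1 & [seq (fun w => nth 0 w i) | i <- iota 4 n]].
  rewrite /= size_map size_iota => /(_ TgP) H.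
  apply: rec_ext (H _) _ => [[|[|[|i]]] /= lt_i|w sz /=]; try by rect.
    by rewrite (nth_map 0) ?size_iota // nth_iota //; apply: rec_var.
  rewrite -map_comp map_nth_drop ?sz // !nth_behead.
  by rewrite -[behead (behead _)]drop1 -[behead _]drop1 -drop1 -[behead _]drop1 !drop_drop.
- by move=> s t [|m v] //= y [sz]; apply: IM.
- move=> v y; have [m [v' ev]] : exists m (v' : n.-tuple nat), v = cons_tuple m v'.
    by exists (thead v), (behead_tuple v); rewrite [LHS]tuple_eta; apply: val_inj.
  subst v; rewrite /= /thead (tnth_nth 0) /=.
  have -> : behead_tuple (cons_tuple m v') = v' by apply: val_inj.
  split=> [[S [fS gS ->]]|[s sP]].
    suff: forall i, i <= m -> exists s, I s v' i = (S i).+1 by apply.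
    elim=> [_|i IHi lt_i]; first exact/TfE.
    have [s sP] := IHi (ltnW lt_i); have /TgE[t tP] := gS i lt_i.
    exists (maxn s t); rewrite /I /= -/(I _ _ _).
    rewrite (IM s _ _ _ (S i)) ?size_tuple ?leq_maxl //=.
    by apply: TgM tP; rewrite /= ?size_tuple // leq_maxr.
  exists (fun i => (I s v' i).-1).
  have nz i : i <= m -> I s v' i = (I s v' i).-1.+1.
    move=> le_i; rewrite prednK // lt0n; apply/eqP => I0.
    suff: I s v' m = 0 by rewrite sP.
    rewrite -(subnKC le_i); elim: (m - i) => [|k IHk]; first by rewrite addn0.
    by rewrite addnS /I /= -/(I _ _ _) IHk.
  split; last by rewrite sP.
    by apply/TfE; exists s; apply: (nz 0).
  move=> i lt_i; apply/TgE; exists s; rewrite -(nz i.+1) // {2}/I /= -/(I _ _ _).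
  by rewrite [in RHS](nz i (ltnW lt_i)).
Qed.

(** The search stops at the first [z] whose stage value is at most 1: value 1 is a converged zero,
    while value 0 is an unfinished computation and blocks the output. *)
Lemma stage_min n (f : mrec n.+1) :
  (exists T, stage_fun (meval f) T) -> exists T, stage_fun (meval (MMin f)) T.
Proof.
move=> [T [TP TM TE]].
pose x s v := bmin (fun z => T [:: s, z & v] <= 1) s.
exists (fun w => if T (nth 0 w 0 :: x (nth 0 w 0) (behead w) :: behead w) == 1
  then (x (nth 0 w 0) (behead w)).+1 else 0).
have xP : total_rec n.+1 (fun w => x (nth 0 w 0) (behead w)).
  apply: rec_bmin; last by recvar.
  apply: dec_leq; last exact: rec_const.
  apply: rec_ext (rec_swap TP) _ => w _; by rewrite nth_behead.
have xE s v y : T [:: s, y & v] = 1 -> y <= s ->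
    (forall z, z < y -> 1 < T [:: s, z & v]) -> x s v = y.
  move=> Ty le_y lt_y; have [_ [ltP _]] := bminP (fun z => T [:: s, z & v] <= 1) s.
  have := @bmin_sat (fun z => T [:: s, z & v] <= 1) s y.
  rewrite Ty => /(_ isT le_y); rewrite -/(x s v) => Tx.
  case: (ltngtP (x s v) y) => // [/lt_y|/ltP].
    by rewrite ltnNge Tx.
  by rewrite Ty.
split.
- apply: rec_if; try by rect.
  apply: dec_eq; last exact: rec_const.
  have := @rec_comp n.+1 T [:: fun w => nth 0 w 0, fun w => x (nth 0 w 0) (behead w)
     & [seq (fun w => nth 0 w i) | i <- iota 1 n]].
  rewrite /= size_map size_iota => /(_ TP) H.
  apply: rec_ext (H _) _ => [[|[|i]] /= lt_i|w sz /=]; try by rect.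
    by rewrite (nth_map 0) ?size_iota // nth_iota //; apply: rec_var.
  by rewrite -map_comp map_nth_drop ?sz // drop1.
- move=> s t v y sz le_st /=; case: eqP => // Tx [<-].
  have [le_x [ltP _]] := bminP (fun z => T [:: s, z & v] <= 1) s.
  have Tt : T [:: t, x s v & v] = 1 by apply: TM Tx; rewrite /= ?sz.
  have -> : x t v = x s v; last by rewrite Tt.
  apply: xE; rewrite ?(leq_trans le_x) // => z /ltP; rewrite -ltnNge.
  case E: (T [:: s, z & v]) => [|k] // k_gt0.
  by rewrite (TM s t _ k) //= sz.
- move=> v y; split=> [[/TE[s0 s0P] lt_y]|[s]].
    have [z s t le_st [k kP]|z /lt_y[k /TE[s sP]]|s sP] := @bounded_collect
      (fun z s => exists k, T [:: s, z & v] = k.+2) y.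
    + by exists k; apply: TM kP; rewrite //= size_tuple.
    + by exists s, k.
    (* The stage must also reach [y], because the bounded search at stage [t] looks no further than
       [t]. *)
    + pose t := maxn (maxn s s0) y.
      have lt_st : s <= t by rewrite /t -maxnA leq_maxl.
      have lt_s0t : s0 <= t by rewrite /t !leq_max leqnn orbT.
      have Ty : T [:: t, y & v] = 1 by apply: TM s0P; rewrite //= size_tuple.
      exists t; rewrite /= (xE t v y) ?Ty ?leq_maxr // => z /sP[k kP].
      by rewrite (TM s t _ k.+1) //= size_tuple.
  rewrite /=; case: eqP => // Tx [<-]; split; first by apply/TE; exists s.
  move=> z; have [_ [ltP _]] := bminP (fun z => T [:: s, z & v] <= 1) s.
  move=> /ltP; rewrite -ltnNge; case E: (T [:: s, z & v]) => [|[|k]] // _.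
  by exists k; apply/TE; exists s.
Qed.

Lemma stage_mrec n (p : mrec n) : exists T, stage_fun (meval p) T.
Proof.
elim: p => {n} [n|| n i|k n f IHf g IHg|n f IHf g IHg|n f IHf].
- exists (fun _ => 1); split=> //; first exact: rec_const.
  by move=> v y /=; split=> [->|[_ []]]; first by exists 0.
- exists (fun w => (nth 0 w 1).+2); split; first by rect.
    by move=> s t v y sz le_st.
  by move=> v y; rewrite /= /thead (tnth_nth 0); split=> [->|[_ []]] //; exists 0.
- exists (fun w => (nth 0 w i.+1).+1); split=> //.
    by apply/rec_succ/rec_var; rewrite ltnS.
  by move=> v y; rewrite /= (tnth_nth 0); split=> [->|[_ []]] //; exists 0.
- exact: stage_comp.
- exact: stage_prec.
- exact: stage_min.
Qed.

(** * Numberings and their enumerable graphs *)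

Lemma num_fun_functional phi e x y1 y2 :
  num_fun phi e x y1 -> num_fun phi e x y2 -> y1 = y2.
Proof.
rewrite /num_fun; have [p pP] := num_partial_recursive phi.
by rewrite !pP; apply: meval_functional.
Qed.

Lemma num_fun_stage phi : exists st : nat -> nat -> nat -> nat,
  [/\ total_rec 3 (fun v => st (nth 0 v 0) (nth 0 v 1) (nth 0 v 2)),
      forall s t e x y, s <= t -> st s e x = y.+1 -> st t e x = y.+1
    & forall e x y, num_fun phi e x y <-> exists s, st s e x = y.+1].
Proof.
have [p pP] := num_partial_recursive phi.
have [T [TP TM TE]] := stage_mrec p.
exists (fun s e x => T [:: s; e; x]); split.
- apply: rec_ext TP _ => -[|a [|b [|c []]]] //.
- by move=> s t e x y le_st; apply: TM.
- by move=> e x y; rewrite /num_fun pP TE.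
Qed.

Lemma re_num_fun phi :
  re 3 (fun v => num_fun phi (nth 0 v 0) (nth 0 v 1) (nth 0 v 2)).
Proof.
have [st [stP _ stE]] := num_fun_stage phi.
apply: (@re_ext _ (fun v => exists s,
    st s (nth 0 v 0) (nth 0 v 1) == (nth 0 v 2).+1)).
  apply: re_ex; apply: re_dec; apply: dec_eq; last by rect.
  by apply: (rec_comp3 stP); rect.
by move=> v _; rewrite stE; split=> -[s /eqP e]; exists s.
Qed.

(** [Q] is the graph of the uniformizing program, enumerable through its stages and single-valued
    because programs are. *)
Lemma re_selection n P : re n.+1 P -> exists Q,
  [/\ re n.+1 Q,
      forall v y, size v = n -> Q (y :: v) -> P (y :: v),
      forall v y, size v = n -> P (y :: v) -> exists z, Q (z :: v)
    & forall v y z, size v = n -> Q (y :: v) -> Q (z :: v) -> y = z].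
Proof.
move=> /re_uniformization[p pP]; have [T [TP TM TE]] := stage_mrec p.
have QE v y (sz : size v = n) : (exists s, T (s :: v) == y.+1) <->
    meval p (Tuple (introT eqP sz)) y.
  by rewrite TE /=; split=> -[s /eqP e]; exists s.
exists (fun w => exists s, T (s :: behead w) == (nth 0 w 0).+1); split.
- apply: re_ex; apply: re_dec; apply: dec_eq; last by rect.
  exact: rec_skip TP.
- by move=> v y sz /= /(QE v y sz); have [H _] := pP (Tuple (introT eqP sz)); apply: H.
- move=> v y sz Py; have [_ H] := pP (Tuple (introT eqP sz)).
  by have [|z /(QE v z sz)] := H; [exists y|exists z].
- by move=> v y z sz /(QE v _ sz) Qy /(QE v _ sz); apply: meval_functional Qy.
Qed.

Lemma numbering_of_graph (W : nat -> nat -> nat -> Prop) :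
  re 3 (fun v => W (nth 0 v 0) (nth 0 v 1) (nth 0 v 2)) ->
  (forall e x y z, W e x y -> W e x z -> y = z) ->
  exists psi, forall e x y, num_fun psi e x y <-> W e x y.
Proof.
move=> WP Wf.
have /re_uniformization[p pP] : re 3 (fun v => W (nth 0 v 1) (nth 0 v 2) (nth 0 v 0)).
  by apply: (re_comp3 WP); rect.
have pr : partial_recursive (meval p) by exists p.
exists (Numbering pr) => e x y; rewrite /num_fun /=.
have [H1 H2] := pP [tuple e; x]; split; first exact: H1.
by move=> Wy; have [|z pz] := H2; [exists y|rewrite (Wf _ _ _ _ Wy (H1 _ pz))].
Qed.

(** * Pairing and the recursion theorem *)

Definition code (a b : nat) : nat := (a + b) * (a + b) + a.

(** Pairs of sum [s] are coded between [s * s] and [s.+1 * s.+1], the latter excluded, so the code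
    determines the sum and then [a]. Decoding is done by existential search in enumerable
    predicates. *)
Lemma code_inj a b c d : code a b = code c d -> a = c /\ b = d.
Proof.
suff H a' b' c' d' : a' + b' < c' + d' -> code a' b' < code c' d'.
  move=> e; have s_eq : a + b = c + d.
    by case: (ltngtP (a + b) (c + d)) => // /H; rewrite e ltnn.
  move: e; rewrite /code s_eq => /addnI e; move: s_eq; rewrite e.
  by move=> /addnI.
move=> lt_s; rewrite /code; apply: leq_trans (leq_addr _ _).
apply: leq_trans (leq_mul lt_s lt_s).
by rewrite mulSn mulnS addnA [_ + (_ * _)]addnC ltn_add2l addSn ltnS -!addnA leq_addr.
Qed.

Lemma rec_code n a b :
  total_rec n a -> total_rec n b -> total_rec n (fun v => code (a v) (b v)).
Proof. by move=> aP bP; rewrite /code; rect. Qed.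

Lemma computable1_rec f : computable1 f -> total_rec 1 (fun v => f (nth 0 v 0)).
Proof.
move=> [p pP]; exists p => v; apply/pP.
by rewrite /thead (tnth_nth 0).
Qed.

Lemma computable2_rec f :
  computable2 f -> total_rec 2 (fun v => f (nth 0 v 0) (nth 0 v 1)).
Proof. by move=> [p pP]; exists p => v; apply/pP; rewrite !(tnth_nth 0). Qed.

(** A fixed point theorem: the programs [e, i |-> G e i] know their own bound
    [h e i], because [h] bounds the diagonal family [phi_e(<<e, i>, x>)] and
    [phi] has an index of every partial recursive function. *)
Lemma recursion phi : computably_bounded phi -> exists h : nat -> nat -> nat,
  total_rec 2 (fun v => h (nth 0 v 0) (nth 0 v 1)) /\
  forall G : nat -> nat -> nat -> nat -> Prop,
    re 4 (fun v => G (nth 0 v 0) (nth 0 v 1) (nth 0 v 2) (nth 0 v 3)) ->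
    (forall e i x y z, G e i x y -> G e i x z -> y = z) ->
    exists e, forall i, exists2 j, j <= h e i & pfun_eq (num_fun phi j) (G e i).
Proof.
move=> cb; have phiP := re_num_fun phi.
have [||psi psiE] := @numbering_of_graph (fun k x y => exists e, exists i,
    k == code e i /\ num_fun phi e (code k x) y).
- do 2!apply: re_ex; apply: re_and.
    by apply: re_dec; apply: dec_eq; [|apply: rec_code]; rect.
  by apply: (re_comp3 phiP); rect; apply: rec_code; rect.
- move=> k x y z [e [i [/eqP-> Py]]] [e' [i' [/eqP/code_inj[<- _] Pz]]].
  exact: num_fun_functional Py Pz.
have [f [/computable1_rec fP fE]] := cb psi.
exists (fun e i => f (code e i)); split.
  by apply: (rec_comp1 fP); apply: rec_code; rect.
move=> G GP Gf.
(* [chi] ignores its index and reads [e], [i] and [x] from the input. An index [e] of [chi_0] in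
   [phi] thus gets itself back when the diagonal family [psi] feeds it [code (code e i) x]. *)
have [||chi chiE] := @numbering_of_graph (fun _ w y => exists k, exists x,
    exists e, exists i, w == code k x /\ (k == code e i /\ G e i x y)).
- do 4!apply: re_ex; apply: re_and.
    by apply: re_dec; apply: dec_eq; [|apply: rec_code]; rect.
  apply: re_and.
    by apply: re_dec; apply: dec_eq; [|apply: rec_code]; rect.
  by apply: (re_comp4 GP); rect.
- move=> _ w y z [k [x [e [i [/eqP-> [/eqP-> Gy]]]]]].
  move=> [k' [x' [e' [i' [/eqP/code_inj[<- <-] [/eqP/code_inj[<- <-]]]]]]].
  exact: Gf.
have [_ [_ /(_ 0)[e _ eE]]] := cb chi.
exists e => i; have [j le_j jE] := fE (code e i); exists j => // x y.
rewrite (jE x y) psiE; split=> [[e' [i' [/eqP/code_inj[<- _] /eE/chiE]]]|Gy].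
  move=> [k [x' [e2 [i2 [/eqP/code_inj[<- <-] [/eqP/code_inj[<- <-]]]]]]].
  exact.
exists e, i; split=> //; apply/eE/chiE.
by exists (code e i), x, e, i; rewrite !eqxx.
Qed.

(** * Least indices, copying and immunity *)

Lemma MIN_least phi e : exists2 j, j <= e &
  MIN phi j /\ pfun_eq (num_fun phi j) (num_fun phi e).
Proof.
elim/ltn_ind: e => e IHe.
case: (classic (MIN phi e)) => [eM|neM]; first by exists e.
have [j lt_j jE] : exists2 j, j < e & pfun_eq (num_fun phi j) (num_fun phi e).
  by apply: NNPP => nj; apply: neM => j lt_j jE; apply: nj; exists j.
have [i le_i [iM iE]] := IHe j lt_j.
exists i; first exact: leq_trans le_i (ltnW lt_j).
by split=> // x y; rewrite (iE x y) (jE x y).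
Qed.

(** Whatever computation selects a number [x] above the bound [beta i] that it
    knows for its own index, it can make [x] non-minimal by copying [phi_x]. *)
Lemma MIN_copy phi (P : nat -> nat -> nat -> Prop) : computably_bounded phi ->
  re 3 (fun v => P (nth 0 v 0) (nth 0 v 1) (nth 0 v 2)) ->
  exists (beta : nat -> nat) (Q : nat -> nat -> Prop),
  [/\ re 2 (fun v => Q (nth 0 v 0) (nth 0 v 1)),
      forall x i, Q x i -> P x i (beta i),
      forall x i, P x i (beta i) -> exists y, Q y i
    & forall x i, Q x i -> beta i < x -> ~ MIN phi x].
Proof.
move=> cb PP; have phiP := re_num_fun phi; have [h [hP rec_h]] := recursion cb.
have [|Q [QP QS QE Qf]] := @re_selection 2 (fun w => P (nth 0 w 0) (nth 0 w 1)
   (h (nth 0 w 2) (nth 0 w 1))).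
  by apply: (re_comp3 PP); rect; apply: (rec_comp2 hP); rect.
have QP' n a b c : total_rec n a -> total_rec n b -> total_rec n c ->
    re n (fun v => Q [:: a v; b v; c v]).
  by move=> aP bP cP; apply: (@re_comp n Q [:: a; b; c]) => // -[|[|[|i]]] //.
(* With parameter [i], the program copies [phi_z] for the selected [z], and is undefined if nothing
   is selected. *)
have [||e eE] := rec_h (fun e i x y => exists z, Q [:: z; i; e] /\ num_fun phi z x y).
- by apply: re_ex; apply: re_and; [apply: QP'|apply: (re_comp3 phiP)]; rect.
- move=> e i x y z [u [Qu uy]] [w [Qw]].
  by rewrite -(Qf [:: i; e] _ _ _ Qu Qw) //; apply: num_fun_functional uy.
exists (h e), (fun x i => Q [:: x; i; e]); split.
- by apply: QP'; rect.
- by move=> x i /QS; apply.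
- by move=> x i Px; apply: (QE [:: i; e] x).
- move=> x i Qx lt_x xM; have [j le_j jE] := eE i.
  apply: (xM j (leq_ltn_trans le_j lt_x)) => u y; rewrite (jE u y).
  split=> [[z [Qz]]|xy]; last by exists x.
  by rewrite -(Qf [:: i; e] _ _ _ Qx Qz).
Qed.

(** If [S] had an element above [beta 0], [MIN_copy] would select such an element and make it
    non-minimal. *)
Lemma MIN_immune phi (S : nat -> Prop) : computably_bounded phi ->
  re 1 (fun v => S (nth 0 v 0)) -> (forall x, S x -> MIN phi x) ->
  exists b, forall x, S x -> x <= b.
Proof.
move=> cb SP SM.
have [|beta [Q [_ QS QE Qn]]] := @MIN_copy phi (fun x i b => S x /\ b < x) cb.
  by apply: re_and; [apply: (re_comp1 SP)|apply: re_dec]; rect.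
exists (beta 0) => x Sx; rewrite leqNgt; apply/negP => lt_x.
have [//|y Qy] := QE x 0; have [Sy lt_y] := QS _ _ Qy.
by apply: (Qn _ _ Qy) => //; apply: SM.
Qed.

(** The [b.+2] constant functions with values below [b.+2] have distinct least indices, so these do
    not all fit among the [b.+1] numbers up to [b]. *)
Lemma MIN_interval phi : computably_bounded phi ->
  exists2 F, total_rec 1 (fun v => F (nth 0 v 0)) &
    forall b, exists2 x, b < x < F b & MIN phi x.
Proof.
move=> cb; have [||psi psiE] := @numbering_of_graph (fun k _ y => y == k).
- by apply: re_dec; rect.
- by move=> k _ y z /eqP-> /eqP->.
have [f [/computable1_rec fP fE]] := cb psi.
(* One plus the sum of [f i] for [i < b.+2], which strictly exceeds each of these [f i]. *)
exists (fun b => primrec 1 (fun i r => r + f i) b.+2).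
  apply: (@rec_primrec 1 _ (fun i r _ => r + f i) (fun v => (nth 0 v 0).+2)); rect.
  by apply: (rec_comp1 fP); rect.
have FP m k : k < m -> f k < primrec 1 (fun i r => r + f i) m.
  elim: m => //= m IHm; rewrite ltnS leq_eqVlt => /orP[/eqP->|/IHm lt_k].
    rewrite -[X in X < _]add0n -addSn leq_add2r.
    by elim: (m) => //= n IHn; apply: leq_trans (leq_addr _ _).
  exact: leq_trans (leq_addr _ _).
move=> b; set F := primrec _ _ _.
have /fin_all_exists[m mP] : forall k : 'I_b.+2, exists x,
    [/\ x < F, MIN phi x & pfun_eq (num_fun phi x) (num_fun psi k)].
  move=> k; have [j le_j jE] := fE k; have [x le_x [xM xE]] := MIN_least phi j.
  exists x; split=> //; last by move=> u y; rewrite (xE u y) (jE u y).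
  exact: leq_ltn_trans (leq_trans le_x le_j) (FP _ _ (ltn_ord k)).
apply: NNPP => none.
have le_m k : m k < b.+1.
  have [lt_F mM _] := mP k; rewrite ltnNge; apply/negP => lt_m.
  by apply: none; exists (m k); rewrite ?lt_m.
have inj : injective (fun k => Ordinal (le_m k)).
  move=> k l [e]; have [_ _ kE] := mP k; have [_ _ lE] := mP l.
  have /lE : num_fun phi (m l) 0 k by rewrite -e; apply/kE/psiE.
  by move=> /psiE/eqP/val_inj.
by have := leq_card _ inj; rewrite !card_ord ltnn.
Qed.

(** * The forest structure on large numbers *)

(** A fold along an interval computes a member [k] such that any member in
    [MIN phi] forces [k] into [MIN phi]; intervals known to meet [MIN phi]
    then give an infinite enumerable subset of it. *)
Lemma MIN_no_tournament phi (S : pred nat) (le : rel nat) b0 :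
  computably_bounded phi -> dec 1 (fun v => S (nth 0 v 0)) ->
  dec 2 (fun v => le (nth 0 v 0) (nth 0 v 1)) ->
  (forall x y, le x y -> MIN phi y -> MIN phi x) ->
  (forall x y, S x -> S y -> le x y || le y x) ->
  ~ (forall x, MIN phi x -> b0 < x -> S x).
Proof.
move=> cb SP leP le_MIN le_total MIN_S.
have [F FP FE] := MIN_interval cb.
(* The initial candidate [0] fails [b < r], so the first member of [S] above [b] replaces it;
   afterwards [r] yields to a member [i] unless [le r i]. *)
pose step b i r := if (b < i) && S i && ~~ ((b < r) && S r && le r i) then i else r.
pose K b n := primrec 0 (step b) n.
have KP : total_rec 2 (fun v => K (nth 0 v 0) (nth 0 v 1)).
  have dS n a : total_rec n a -> dec n (fun v => S (a v)).
    exact: (@rec_comp1 _ (fun x => nat_of_bool (S x))).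
  have dle n a c : total_rec n a -> total_rec n c -> dec n (fun v => le (a v) (c v)).
    exact: (@rec_comp2 _ (fun x y => nat_of_bool (le x y))).
  apply: (@rec_primrec 2 (fun _ => 0) (fun i r v => step (nth 0 v 0) i r)
    (fun v => nth 0 v 1)); try by rect.
  by rewrite /step; rect; (apply: dS || apply: dle); rect.
have KE b n : b0 <= b -> (exists2 x, b < x < n & MIN phi x) ->
    b < K b n /\ MIN phi (K b n).
  move=> le_b [x /andP[lt_x +] xM]; elim: n => // n IHn.
  have S_of y : b < y -> MIN phi y -> S y.
    by move=> lt_y yM; apply: MIN_S yM (leq_ltn_trans le_b lt_y).
  rewrite ltnS leq_eqVlt /K /= -/(K b n) /step => /orP[/eqP <-|lt_n].
    rewrite lt_x S_of //=; case: ifP => [//|/negbFE/andP[/andP[lt_K _] le_K]].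
    by split=> //; apply: le_MIN le_K xM.
  have [lt_K KM] := IHn lt_n; case: ifP => // /andP[/andP[lt_bn Sn]].
  rewrite lt_K S_of //= => nle; split=> //; apply: (le_MIN _ _ _ KM).
  by have := le_total _ _ Sn (S_of _ lt_K KM); rewrite (negPf nle) orbF.
have [||B BP] := @MIN_immune phi (fun x => exists b, b0 <= b /\ x == K b (F b)) cb.
- apply: re_ex; apply: re_and; first by apply: re_dec; rect.
  apply: re_dec; rect; apply: (rec_comp2 KP); first by rect.
  by apply: (rec_comp1 FP); rect.
- by move=> x [b [le_b /eqP->]]; have [] := KE b (F b) le_b (FE b).
have [lt_K _] := KE (maxn b0 B) (F (maxn b0 B)) (leq_maxl _ _) (FE _).
suff le_K : K (maxn b0 B) (F (maxn b0 B)) <= B.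
  by move: (leq_trans lt_K le_K); rewrite ltnNge leq_maxr.
by apply: BP; exists (maxn b0 B); rewrite leq_maxl.
Qed.

(** The vector [(1, 1)] is ruled out for large pairs, since copying [phi_x] would
    put [y] into [MIN phi]. *)
Lemma MIN_forest phi : computably_bounded phi -> recursive_1_2 (MIN phi) ->
  exists (le inc : rel nat) (b0 : nat),
  [/\ dec 2 (fun v => le (nth 0 v 0) (nth 0 v 1)),
      dec 2 (fun v => inc (nth 0 v 0) (nth 0 v 1)),
      forall x y, le x y -> MIN phi y -> MIN phi x,
      forall x y, inc x y -> MIN phi x -> ~ MIN phi y
    & forall x y, b0 < x -> b0 < y -> [|| le x y, le y x | inc x y]].
Proof.
move=> cb [f [/computable2_rec fP1 /computable2_rec fP2 fE]].
have f1P n a b : total_rec n a -> total_rec n b -> dec n (fun v => (f (a v) (b v)).1).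
  exact: (@rec_comp2 _ (fun x y => nat_of_bool (f x y).1)).
have f2P n a b : total_rec n a -> total_rec n b -> dec n (fun v => (f (a v) (b v)).2).
  exact: (@rec_comp2 _ (fun x y => nat_of_bool (f x y).2)).
have [|beta [Q [QP QS QE Qn]]] := @MIN_copy phi (fun x i b =>
    b < x /\ exists y, i < y /\ (f x y).1 && (f x y).2) cb.
  apply: re_and; first by apply: re_dec; rect.
  apply: re_ex; apply: re_and; apply: re_dec; rect.
    by apply: f1P; rect.
  by apply: f2P; rect.
(* The selected [x] is non-minimal, so the first label of [(1, 1)] is wrong and every such [y] is
   minimal; immunity bounds them by [B]. *)
have [||B BP] := @MIN_immune phi (fun y => exists i, exists x,
    Q x i /\ (i < y) && (f x y).1 && (f x y).2) cb.
- do 2!apply: re_ex; apply: re_and; first by apply: (re_comp2 QP); rect.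
  by apply: re_dec; rect; [apply: f1P|apply: f2P]; rect.
- move=> y [i [x [Qxi /andP[/andP[_ f1] f2]]]].
  have [lt_x _] := QS _ _ Qxi; have := Qn _ _ Qxi lt_x.
  by case: (fE x y); rewrite /char_val ?f1 ?f2 => -[H1 H2]; [case; apply: H2|move=> _; apply: H2].
(* [le x y] reads off the vector [(1, 0)] on [(x, y)] or [(0, 1)] on [(y, x)]; [inc] is the vector
   [(0, 0)]. *)
exists (fun x y => ((f x y).1 && ~~ (f x y).2) || (~~ (f y x).1 && (f y x).2)).
exists (fun x y => ~~ (f x y).1 && ~~ (f x y).2), (maxn B (beta B)); split.
- by rect; (apply: f1P || apply: f2P); rect.
- by rect; (apply: f1P || apply: f2P); rect.
- move=> x y /orP[/andP[f1 /negPf f2]|/andP[/negPf f1 f2]] yM.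
    by case: (fE x y); rewrite /char_val ?f1 ?f2 => -[H1 H2]; [apply: H2|have := H1 yM].
  by case: (fE y x); rewrite /char_val ?f1 ?f2 => -[H1 H2]; [have := H1 yM|apply: H2].
- move=> x y /andP[/negPf f1 /negPf f2] xM yM.
  by case: (fE x y); rewrite /char_val ?f1 ?f2 => -[H1 H2]; [have := H1 xM|have := H1 yM].
- move=> x y; rewrite !gtn_max => /andP[ltBx ltbx] /andP[ltBy _].
  have : ~~ ((f x y).1 && (f x y).2).
    (* With parameter [B], such a pair makes [Q] select some [z] having a partner [y'] above [B],
       against [BP]. *)
    apply/negP => f12; have [|z Qz] := QE x B.
      by split=> //; exists y.
    have [lt_z [y' [lt_y' f']]] := QS _ _ Qz.
    have := BP y'; rewrite leqNgt lt_y' => H; have: false; last by [].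
    by apply: H; exists B, z; rewrite lt_y'.
  by case: (f x y) => -[] [] //=; rewrite ?orbT /= ?orbT.
Qed.

(** * Finite tables and stagewise approximations to minimality *)

Lemma dec_finite (P : nat -> Prop) m : exists E : pred nat,
  dec 1 (fun v => E (nth 0 v 0)) /\ forall j, E j <-> j < m /\ P j.
Proof.
elim: m => [|m [E [EP EE]]].
  by exists xpred0; split=> [|j]; [exact: dec_const|split=> // -[]].
(* The table is chosen classically, entry by entry; no decision procedure for [P] itself is
   involved. *)
case: (classic (P m)) => Pm.
  exists (fun j => (j == m) || E j); split; first by rect.
  move=> j; rewrite ltnS leq_eqVlt; split=> [/orP[/eqP->|/EE[lt_j Pj]]|].
  - by rewrite eqxx.
  - by rewrite lt_j orbT.
  - by case=> /orP[-> //|lt_j Pj]; apply/orP; right; apply/EE.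
exists E; split=> // j; split=> [/EE[lt_j Pj]|[]]; first by rewrite ltnS ltnW.
by rewrite ltnS leq_eqVlt => /orP[/eqP->|lt_j Pj] //; apply/EE.
Qed.

(** Each [i < y] differs from [y] at some argument, where one side attains a value that the other
    never does; from some stage on the approximations there differ forever. [w0] bounds these
    arguments and stages for all [i < y]. *)
Lemma MIN_stage_witness phi st y :
  (forall s t e x z, s <= t -> st s e x = z.+1 -> st t e x = z.+1) ->
  (forall e x z, num_fun phi e x z <-> exists s, st s e x = z.+1) ->
  MIN phi y -> exists w0, forall w, w0 <= w -> forall s i, w <= s -> i < y ->
    exists2 n, n <= w & st s i n <> st s y n.
Proof.
move=> stM stE yM.
have [i s t le_st|i lt_i|w0 w0P] := @bounded_collect (fun i w => exists2 n, n <= w &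
    forall s, w <= s -> st s i n <> st s y n) y.
- move=> [n le_n nP]; exists n; first exact: leq_trans le_st.
  by move=> u /(leq_trans le_st); apply: nP.
- have sep a b n z : num_fun phi a n z -> ~ num_fun phi b n z ->
      exists s0, forall s, s0 <= s -> st s a n <> st s b n.
    move=> /stE[s0 s0P] nb; exists s0 => s le_s e; apply: nb; apply/stE.
    by exists s; rewrite -e; apply: stM s0P.
  suff [n [s0 s0P]] : exists n s0, forall s, s0 <= s -> st s i n <> st s y n.
    exists (maxn n s0), n; first exact: leq_maxl.
    by move=> s; rewrite geq_max => /andP[_]; apply: s0P.
  apply: NNPP => none; apply: (yM i lt_i) => n z.
  split=> nz; apply: NNPP => nnz; apply: none; exists n.
    exact: sep nz nnz.
  by have [s0 s0P] := sep _ _ _ _ nz nnz; exists s0 => s /s0P ne /esym.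
- exists w0 => w le_w s i le_s /w0P[n le_n nP].
  exists n; first exact: leq_trans le_w.
  by apply: nP; apply: leq_trans le_s.
Qed.

(** Take a smaller index [i] of the same function: on the finitely many arguments up to [w], both
    approximations eventually agree. *)
Lemma not_MIN_stage phi st y w :
  (forall s t e x z, s <= t -> st s e x = z.+1 -> st t e x = z.+1) ->
  (forall e x z, num_fun phi e x z <-> exists s, st s e x = z.+1) ->
  ~ MIN phi y -> exists s, w <= s /\ exists i, i < y /\
    forall n, n < w.+1 -> st s i n = st s y n.
Proof.
move=> stM stE nyM.
have [i lt_i iE] : exists2 i, i < y & pfun_eq (num_fun phi i) (num_fun phi y).
  by apply: NNPP => none; apply: nyM => i lt_i iE; apply: none; exists i.
have [n s t le_st H u /(leq_trans le_st)/H //|n _|s sP] := @bounded_collect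
  (fun n s => forall t, s <= t -> st t i n = st t y n) w.+1; last first.
  exists (maxn w s); rewrite leq_maxl; split=> //.
  by exists i; split=> // n /sP; apply; rewrite leq_maxr.
case: (classic (exists z, num_fun phi y n z)) => [[z yz]|none].
  have [s sP] := (stE y n z).1 yz; have [t tP] := (stE i n z).1 ((iE n z).2 yz).
  exists (maxn s t) => u; rewrite geq_max => /andP[le_s le_t].
  by rewrite (stM _ _ _ _ _ le_s sP) (stM _ _ _ _ _ le_t tP).
(* Both computations diverge here, so the stage values are [0] throughout. *)
exists 0 => t _; case Ei: (st t i n) => [|a].
  case Ey: (st t y n) => [//|a]; case: none.
  by exists a; apply/stE; exists t.
by case: none; exists a; apply/iE/stE; exists t.
Qed.

(** * The diagonal construction *)

Theorem theorem5p4 (phi : numbering) (hphi : computably_bounded phi) :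
  ~ recursive_1_2 (MIN phi).
Proof.
move=> /(MIN_forest hphi)[le [inc [b0 [leP incP le_MIN inc_MIN tri]]]].
have [st [stP stM stE]] := num_fun_stage phi.
have [h [hP rec_h]] := recursion hphi.
have dle n a c : total_rec n a -> total_rec n c -> dec n (fun v => le (a v) (c v)).
  exact: (@rec_comp2 _ (fun x y => nat_of_bool (le x y))).
have dinc n a c : total_rec n a -> total_rec n c -> dec n (fun v => inc (a v) (c v)).
  exact: (@rec_comp2 _ (fun x y => nat_of_bool (inc x y))).
(* Otherwise the [y > b0] with [le y j] are pairwise comparable and include every minimal number
   above [b0], against [MIN_no_tournament]. *)
have outside j : b0 < j -> ~ MIN phi j ->
    (exists p q, le p j && le q j && inc p q) \/
    (exists y, [/\ MIN phi y, b0 < y & inc j y]).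
  move=> lt_j njM; apply: NNPP => none.
  apply: (@MIN_no_tournament phi (fun y => (b0 < y) && le y j) le b0) => //.
  - by rect; apply: dle; rect.
  - move=> p q /andP[lt_p le_p] /andP[lt_q le_q].
    have /or3P[->|->|inc_pq] := tri p q lt_p lt_q; rewrite ?orbT //.
    by case: none; left; exists p, q; rewrite le_p le_q.
  - move=> y yM lt_y; rewrite lt_y /=.
    have /or3P[le_jy|//|inc_jy] := tri j y lt_j lt_y.
      by case: njM; apply: le_MIN le_jy yM.
    by case: none; right; exists y.
have [z zE] : exists z, forall x y, num_fun phi z x y <-> y == 0.
  have [||psi psiE] := @numbering_of_graph (fun _ _ y => y == 0).
  - by apply: re_dec; rect.
  - by move=> _ _ y y' /eqP-> /eqP->.
  have [f [_ /(_ 0)[z _ zE]]] := hphi psi.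
  by exists z => x y; rewrite (zE x y).
(* Above [maxn b0 z] an index of the zero function is non-minimal, because of [z], and [outside]
   applies to it; the indices up to there go into the table. *)
have [E [EP EE]] := dec_finite (fun j => forall x y, num_fun phi j x y <-> y == 0)
  (maxn b0 z).+1.
have dE n a : total_rec n a -> dec n (fun v => E (a v)).
  exact: (@rec_comp1 _ (fun x => nat_of_bool (E x))).
(* [refuted j w]: the bound [w] witnesses neither that [phi_j] is not the zero
   function, nor that [j] is non-minimal; [E] collects the finitely many
   indices of the zero function for which neither need have a witness. *)
pose refuted j w := ~~ E j /\ (forall n, n < w.+1 -> exists s, st s j n == 1) /\
  (forall p, p < w.+1 -> forall q, q < w.+1 -> ~~ (le p j && le q j && inc p q)) /\
  (forall y, y < w.+1 -> (y <= b0) || ~~ inc j y \/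
     exists s, w <= s /\ exists i, i < y /\
       forall n, n < w.+1 -> st s i n == st s y n).
have refutedP n a b : total_rec n a -> total_rec n b ->
    re n (fun v => refuted (a v) (b v)).
  apply: re_comp2; rewrite /refuted.
  have stP' := rec_comp3 stP.
  apply: re_and; first by apply: re_dec; rect; apply: dE; rect.
  apply: re_and.
    apply: re_ball; last by rect.
    by apply: re_ex; apply: re_dec; rect; apply: stP'; rect.
  apply: re_and.
    do 2!(apply: re_ball; last by rect).
    by apply: re_dec; rect; (apply: dle || apply: dinc); rect.
  apply: re_ball; last by rect.
  apply: re_or; first by apply: re_dec; rect; apply: dinc; rect.
  apply: re_ex; apply: re_and; first by apply: re_dec; rect.
  apply: re_ex; apply: re_and; first by apply: re_dec; rect.
  apply: re_ball; last by rect.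
  by apply: re_dec; rect; apply: stP'; rect.
(* The zero function, defined at [x] as long as every [w < x] leaves some [j] up to the program's
   own index bound refuted. *)
have [||e eE] := rec_h (fun e _ x y => y == 0 /\
    forall w, w < x -> exists j, j <= h e 0 /\ refuted j w).
- apply: re_and; first by apply: re_dec; rect.
  apply: re_ball; last by rect.
  apply: re_ex; apply: re_and; last by apply: refutedP; rect.
  by apply: re_dec; rect; apply: (rec_comp2 hP); rect.
- by move=> e i x y y' [/eqP-> _] [/eqP->].
have [j0 le_j0 j0E] := eE 0; have [j le_j [jM jE']] := MIN_least phi j0.
set b := h e 0 in j0E le_j0.
have jE x y : num_fun phi j x y <-> y == 0 /\
    forall w, w < x -> exists j, j <= b /\ refuted j w.
  by rewrite (jE' x y) (j0E x y).
have le_jb : j <= b := leq_trans le_j le_j0.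
have ev_unrefuted k : exists w0, forall w, w0 <= w -> ~ refuted k w.
  case: (classic (forall n, exists s, st s k n = 1)) => [k0|]; last first.
    move=> nk0; have [n nP] : exists n, forall s, st s k n <> 1.
      apply: NNPP => none; apply: nk0 => n; apply: NNPP => ns.
      by apply: none; exists n => s es; apply: ns; exists s.
    (* From [n] on, the bound covers an argument at which [phi_k] does not take the value [0]. *)
    exists n => w le_w [_ [/(_ n)]]; rewrite ltnS => /(_ le_w)[s /eqP].
    by move=> /nP.
  have kE x y : num_fun phi k x y <-> y == 0.
    have k0x : num_fun phi k x 0 by apply/stE.
    by split=> [/(num_fun_functional k0x) <-|/eqP->].
  case: (boolP (E k)) => Ek; first by exists 0 => w _ []; rewrite Ek.
  have : ~~ (k < (maxn b0 z).+1).
    by apply: contra Ek => lt_k; apply/EE.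
  rewrite ltnS -ltnNge gtn_max => /andP[lt_b0 lt_z].
  have nkM : ~ MIN phi k.
    by move=> /(_ z lt_z); apply=> x y; rewrite zE kE.
  case: (outside k lt_b0 nkM) => [[p [q pq]]|[y [yM lt_y inc_y]]].
    exists (maxn p q) => w; rewrite geq_max => /andP[le_p le_q].
    by move=> [_ [_ [/(_ p le_p q le_q)]]]; rewrite pq.
  have [w0 w0P] := MIN_stage_witness stM stE yM.
  (* [y <= w] brings [y] into the range of the last clause, and [w0 <= w] lets every stage from [w]
     on separate [y] from all smaller indices. *)
  exists (maxn y w0) => w; rewrite geq_max => /andP[le_y le_w0].
  move=> [_ [_ [_ /(_ y le_y)]]]; rewrite leqNgt lt_y inc_y /=.
  case=> // -[s [le_s [i [lt_i H]]]].
  have [n le_n] := w0P w le_w0 s i le_s lt_i; apply.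
  exact/eqP/H.
have [W WP] : exists W, forall k, k < b.+1 -> ~ refuted k W.
  have [k s t le_st H w /(leq_trans le_st)/H //|k _|W WP] := @bounded_collect
    (fun k w0 => forall w, w0 <= w -> ~ refuted k w) b.+1; first exact: ev_unrefuted.
  by exists W => k /WP; apply.
pose good w := forall k, k < b.+1 -> ~ refuted k w.
(* The program is defined exactly up to the least good bound [w]. *)
have [w [wG wmin]] : exists w, good w /\ forall w', w' < w -> ~ good w'.
  elim/ltn_ind: W WP => W IHW WG.
  case: (classic (exists2 w', w' < W & good w')) => [[w' lt_w gw]|none].
    exact: IHW lt_w gw.
  by exists W; split=> // w' lt_w gw; apply: none; exists w'.
have refuted_below w' : w' < w -> exists k, k <= b /\ refuted k w'.
  move=> /wmin ng; apply: NNPP => none; apply: ng => k lt_k kr.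
  by apply: none; exists k.
have j_zero x : x <= w -> num_fun phi j x 0.
  by move=> le_x; apply/jE; split=> // w' lt_w'; apply/refuted_below/(leq_trans lt_w').
(* The contradiction: [j], the least index of the program's function, is itself refuted at [w]. It
   is not in [E], since the function is undefined at [w.+1]. *)
apply: (wG j); first by rewrite ltnS.
split; first apply/negP => /EE[_ jz].
  have /jE[_ /(_ w (ltnSn w))[k [le_k kr]]] : num_fun phi j w.+1 0 by apply/jz.
  exact: wG kr.
split; first by move=> n; rewrite ltnS => /j_zero/stE[s /eqP]; exists s.
split.
  move=> p _ q _; apply/negP => /andP[/andP[le_p le_q] inc_pq].
  (* Minimality of [j] passes to [p] and [q], which are incompatible. *)
  by apply: inc_MIN inc_pq _ _; [apply: le_MIN le_p jM|apply: le_MIN le_q jM].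
move=> y _; case: (boolP ((y <= b0) || ~~ inc j y)) => [|]; first by left.
rewrite negb_or negbK => /andP[_ inc_jy]; right.
(* A [y] incompatible with the minimal [j] is non-minimal, and this shows at a late stage. *)
have [s [le_s [i [lt_i H]]]] := not_MIN_stage w stM stE (inc_MIN _ _ inc_jy jM).
by exists s; split=> //; exists i; split=> // n /H/eqP.
Qed.
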